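(* Let $L=L(q,\bar q,\partial_tq,\partial_{\bar t}\bar q,t,\bar t)$ be a smooth real-valued Lagrangian satisfying the Legendre-like condition $$\det\left(\left(\frac{\partial^2L}{\partial(\partial_tq)\,\partial(\partial_{\bar t}\bar q)}\right)^2-\frac{\partial^2L}{\partial(\partial_tq)^2}\frac{\partial^2L}{\partial(\partial_{\bar t}\bar q)^2}\right)\ne0.$$ Define $p=\frac{\partial L}{\partial(\partial_tq)}$, correspondingly $\bar p=\frac{\partial L}{\partial(\partial_{\bar t}\bar q)}$, and $$H(q,\bar q,p,\bar p,t,\bar t)=p\,\partial_tq+\bar p\,\partial_{\bar t}\bar q-L(q,\bar q,\partial_tq,\partial_{\bar t}\bar q,t,\bar t),$$ where $(\partial_tq,\partial_{\bar t}\bar q)$ is seen as a function of $(q,\bar q,p,\bar p,t,\bar t)$ by the inverse function theorem. Then the Euler–Lagrange equations $$\frac{\partial L}{\partial q}=\partial_t\frac{\partial L}{\partial(\partial_tq)},\qquad\frac{\partial L}{\partial\bar q}=\partial_{\bar t}\frac{\partial L}{\partial(\partial_{\bar t}\bar q)}$$ are equivalent to the Hamiltonian equations $$\partial_tq=\frac{\partial H}{\partial p},\qquad-\partial_tp=\frac{\partial H}{\partial q}.$$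
   Context: Here $q=q_1+iq_2$ stands for maps $(q_1,q_2):\mathbb{T}^2\to\mathbb{T}^{2d}=\mathbb{T}^d\times\mathbb{T}^d$, $\bar q=q_1-iq_2$, and $\mathbb{T}^2$ has coordinates $(t_1,t_2)$ with $t=t_1+it_2$, $\bar t=t_1-it_2$, $\partial_t=\frac12(\partial_{t_1}-i\partial_{t_2})$, $\partial_{\bar t}=\frac12(\partial_{t_1}+i\partial_{t_2})$. Derivatives with respect to complex variables are Wirtinger derivatives, e.g. $\frac{\partial}{\partial q}=\frac12\left(\frac{\partial}{\partial q_1}-i\frac{\partial}{\partial q_2}\right)$; the variable $\partial_{\bar t}\bar q$ is the complex conjugate of $\partial_tq$. Since $L$ and $H$ are real-valued, conjugate equations hold simultaneously. Products such as $p\,\partial_tq$ denote sums over the $d$ components.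
   Formalization: For d>1 the printed determinant condition does not imply that the velocity is locally a function of p, so existence of the local inverse additionally assumes the Jacobian of the velocity-to-momentum map is nonsingular; the equivalence is proved for every differentiable local inverse. *)

(* Defs.v *)
From mathcomp Require Import all_boot all_order all_algebra.
From mathcomp Require Import all_classical all_reals all_analysis.
From mathcomp Require Import complex.

Set Implicit Arguments.
Unset Strict Implicit.
Unset Printing Implicit Defensive.

Import Order.TTheory GRing.Theory Num.Theory.
Import numFieldNormedType.Exports.

Local Open Scope classical_set_scope.
Local Open Scope ring_scope.
Local Open Scope complex_scope.

(* Class C^k on a finite-dimensional space, with directional derivatives in
   place of partial derivatives so that no basis has to be chosen. *)
Fixpoint Ck (R : realType) (V W : normedModType R) (k : nat) (f : V -> W)
    : Prop :=
  match k with
  | 0 => continuous f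
  | k'.+1 => (forall x, differentiable f x) /\ forall v, Ck k' ('D_v f)
  end.

Definition smooth (R : realType) (V W : normedModType R) (f : V -> W) : Prop :=
  forall k, Ck k f.

(* Wirtinger derivatives of a complex-valued function on a real normed space.
   The pair e gives the directions of the real and of the imaginary part of
   the complex variable:
     wirt e = (1/2) (D_{e.1} - i D_{e.2}),
     wirtbar e = (1/2) (D_{e.1} + i D_{e.2}). *)
Section Wirtinger.
Variables (R : realType) (V : normedModType R).

Definition cderive (v : V) (f : V -> R[i]) (x : V) : R[i] :=
  'D_v (fun y => complex.Re (f y)) x +i* 'D_v (fun y => complex.Im (f y)) x.

Definition wirt (e : V * V) (f : V -> R[i]) (x : V) : R[i] :=
  2^-1 * (cderive e.1 f x - 'i%C * cderive e.2 f x).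

Definition wirtbar (e : V * V) (f : V -> R[i]) (x : V) : R[i] :=
  2^-1 * (cderive e.1 f x + 'i%C * cderive e.2 f x).

End Wirtinger.

(* C^d as a real vector space: z = z.1 + i z.2. *)
Notation Cvec R d := ('rV[R]_d * 'rV[R]_d)%type.

Notation plane R := (R * R)%type.

(* Points (q, w, t), with w standing for the velocity d_t q in the domain of
   the Lagrangian and for the momentum p in the domain of the Hamiltonian. *)
Notation phase R d := (Cvec R d * Cvec R d * plane R)%type.

Section Field.
Variables (R : realType) (d : nat).

Local Notation Cvec := (Cvec R d).
Local Notation plane := (plane R).
Local Notation phase := (phase R d).

Definition coord (z : Cvec) (j : 'I_d) : R[i] := z.1 0 j +i* z.2 0 j.

Definition of_coord (c : 'I_d -> R[i]) : Cvec :=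
  (\row_j complex.Re (c j), \row_j complex.Im (c j)).

Definition dir_q (j : 'I_d) : phase * phase :=
  ((((delta_mx 0 j, 0), 0), 0), (((0, delta_mx 0 j), 0), 0)).

Definition dir_w (j : 'I_d) : phase * phase :=
  (((0, (delta_mx 0 j, 0)), 0), ((0, (0, delta_mx 0 j)), 0)).

Definition dir_t : plane * plane := ((1, 0), (0, 1)).

(* T = R / Z.  Functions on tori are periodic functions on the universal cover,
   maps between tori are lifts to the universal covers. *)
Definition int_plane (k : plane) : Prop :=
  k.1 \is a Num.int /\ k.2 \is a Num.int.

Definition int_Cvec (m : Cvec) : Prop :=
  forall j, m.1 0 j \is a Num.int /\ m.2 0 j \is a Num.int.

Definition periodic_phase (L : phase -> R) : Prop :=
  forall q w t m k, int_Cvec m -> int_plane k ->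
    L (q + m, w, t + k) = L (q, w, t).

Definition torus_map (q : plane -> Cvec) : Prop :=
  smooth q /\
  forall t k, int_plane k -> exists2 m, int_Cvec m & q (t + k) = q t + m.

Definition torus_momentum (p : plane -> Cvec) : Prop :=
  smooth p /\ forall t k, int_plane k -> p (t + k) = p t.

Definition dt (q : plane -> Cvec) (t : plane) : Cvec :=
  of_coord (fun j => wirt dir_t (fun s => coord (q s) j) t).

Definition jet (q : plane -> Cvec) (t : plane) : phase := (q t, dt q t, t).

Section Lagrangian.
Variable L : phase -> R.

Definition LC (x : phase) : R[i] := (L x)%:C.

Definition L_vv (x : phase) : 'M[R[i]]_d :=
  \matrix_(i, j) wirt (dir_w i) (wirt (dir_w j) LC) x.
Definition L_vvbar (x : phase) : 'M[R[i]]_d :=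
  \matrix_(i, j) wirt (dir_w i) (wirtbar (dir_w j) LC) x.
Definition L_vbarvbar (x : phase) : 'M[R[i]]_d :=
  \matrix_(i, j) wirtbar (dir_w i) (wirtbar (dir_w j) LC) x.

Definition legendre_like : Prop :=
  forall x, \det (L_vvbar x *m L_vvbar x - L_vv x *m L_vbarvbar x) != 0.

(* Jacobian of (v, vbar) |-> (p, pbar), p = dL/dv, at fixed (q, t).  For d = 1
   its determinant is, up to sign, the one in legendre_like; for d > 1 the
   blocks need not commute and neither determinant controls the other. *)
Definition momentum_jacobian (x : phase) : 'M[R[i]]_(d + d) :=
  block_mx (L_vv x) (L_vvbar x) (L_vvbar x)^T (L_vbarvbar x).

Definition momentum (x : phase) : Cvec :=
  of_coord (fun j => wirt (dir_w j) LC x).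

(* (q, v, t) |-> (q, dL/dv, t) is a bijection from the open set U onto the open
   set W, with inverse (q, p, t) |-> (q, V (q, p, t), t).  The values of V
   outside W are irrelevant. *)
Definition local_inverse (U W : set phase) (V : phase -> Cvec) : Prop :=
  [/\ open U, open W, (forall y, W y -> differentiable V y),
      (forall q v t, U (q, v, t) ->
         W (q, momentum (q, v, t), t) /\ V (q, momentum (q, v, t), t) = v)
    & (forall q p t, W (q, p, t) ->
         U (q, V (q, p, t), t) /\ momentum (q, V (q, p, t), t) = p)].

Definition hamiltonian (V : phase -> Cvec) (y : phase) : R[i] :=
  let: (q, p, t) := y in
  \sum_(j < d) (coord p j * coord (V y) j
                + (coord p j)^* * (coord (V y) j)^*) - LC (q, V y, t).

Definition euler_lagrange (q : plane -> Cvec) (t : plane) : Prop :=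
  forall j,
    wirt (dir_q j) LC (jet q t)
      = wirt dir_t (fun s => wirt (dir_w j) LC (jet q s)) t
    /\
    wirtbar (dir_q j) LC (jet q t)
      = wirtbar dir_t (fun s => wirtbar (dir_w j) LC (jet q s)) t.

Definition hamilton (V : phase -> Cvec) (q p : plane -> Cvec) (t : plane)
    : Prop :=
  forall j,
    wirt dir_t (fun s => coord (q s) j) t
      = wirt (dir_w j) (hamiltonian V) (q t, p t, t)
    /\
    - wirt dir_t (fun s => coord (p s) j) t
      = wirt (dir_q j) (hamiltonian V) (q t, p t, t).

End Lagrangian.
End Field.

(* Main.v *)
Require Import Defs.
From HB Require Import structures.
From mathcomp Require Import all_boot all_order all_algebra.
From mathcomp Require Import all_classical all_reals all_analysis.
From mathcomp Require Import complex.
From mathcomp Require Import ring lra.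

Import Order.TTheory GRing.Theory Num.Theory.
Import numFieldNormedType.Exports.

Local Open Scope classical_set_scope.
Local Open Scope ring_scope.

Set Implicit Arguments.
Unset Strict Implicit.
Unset Printing Implicit Defensive.

(** The equivalence is the classical Legendre duality.  Write the Hamiltonian
    as H = 2 Re (p . V) - L (q, V, t), where V (q, p, t) is the velocity with
    momentum p.  When H is differentiated, the derivative of V contributes
    2 Re (p . dV) - dL (0, dV, 0), which is zero because p is the derivative
    of L in the velocity (diff_velocity_pairing, derive_legendre_transform).
    What remains is dH/dp = V and dH/dq = - dL/dq
    (wirt_momentum_hamiltonian, wirt_position_hamiltonian).  The first Hamilton
    equation thus says that d_t q = V (q, p, t), that is, p is the momentum of
    the jet of q, and the second one becomes dL/dq = d_t p (hamiltonP).  On an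
    open set of times p can then be exchanged with dL/dv under d_t, which gives
    the first Euler-Lagrange equation; the second one is its conjugate because
    L is real (euler_lagrangeP).

    The inverse V exists locally by the inverse function theorem applied to
    (q, v, t) |-> (q, dL/dv, t).  The theorem is proved here from
    strict differentiability: after composition with the inverse of the
    derivative the map differs from the identity by a 1/2-Lipschitz map,
    equations are solved by a contraction (half_isometry_onto), and the
    inverse is differentiable because it is Lipschitz
    (half_isometry_local_inverse, inverse_function).  A C^1 function
    on a finite-dimensional space is strictly differentiable by the mean value
    theorem (C1_strict_diff).

    It remains to see that the derivative of the Legendre map is invertible,
    that is, injective.  A real variation of the velocity annihilated by the
    derivative of the momentum, written together with its conjugate, is a row
    vector in the kernel of momentum_jacobian (hessian_injective); this uses
    that second derivatives commute (derive_comm).  The determinant of that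
    matrix is nonzero by hypothesis when d > 1, and follows from the
    Legendre-like condition when d <= 1 (momentum_jacobian_small). *)

(** * Complete spaces and contractions *)

(** Stated as a property of the normed space, so that the product keeps the
    structure it carries as a normed space. *)
Definition complete_space (R : realType) (E : normedModType R) : Prop :=
  forall F : set_system E, ProperFilter F -> cauchy F -> exists l : E, F --> l.

Lemma complete_space_real (R : realType) : complete_space (R : normedModType R).
Proof. by move=> F FF /cauchy_cvg/cvg_ex. Qed.

Lemma complete_space_row (R : realType) (n : nat) : complete_space 'rV[R]_n.
Proof. by move=> F FF /cauchy_cvg/cvg_ex. Qed.

Lemma complete_space_prod (R : realType) (U V : normedModType R) :
  complete_space U -> complete_space V -> complete_space (U * V)%type.
Proof.
move=> cU cV F FF Fc.
have c1 : cauchy (fst @ F).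
  move=> A entA; rewrite near_simpl -near2E near_map2; apply: Fc.
  have := prod_entP entA (@entourageT V).
  by apply: filterS => -[[a b] [c e]] /= [].
have c2 : cauchy (snd @ F).
  move=> A entA; rewrite near_simpl -near2E near_map2; apply: Fc.
  have := prod_entP (@entourageT U) entA.
  by apply: filterS => -[[a b] [c e]] /= [].
have [l1 Fl1] := cU _ _ c1.
have [l2 Fl2] := cV _ _ c2.
exists (l1, l2).
apply: cvg_trans (cvg_pair Fl1 Fl2).
move=> A hA; have : F [set x | A (x.1, x.2)] by exact: hA.
by rewrite [X in F X](_ : _ = A)//; apply: eq_set => -[].
Qed.

Lemma banach_fixed_point_complete (R : realType) (E : normedModType R)
    (C : set E) (f : {fun C >-> C}) :
  complete_space E -> is_contraction f -> closed C -> C !=set0 ->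
  exists2 w, C w & w = f w.
Proof.
move=> cE.
have cvgE (F : set_system E) : ProperFilter F -> cauchy F -> cvg F.
  by move=> FF /(cE _ FF)[l Fl]; apply/cvg_ex; exists l.
pose X : completeNormedModType R :=
  HB.pack (NormedModule.sort E) (Uniform_isComplete.Build E cvgE).
exact: (@banach_fixed_point R X C f).
Qed.

(** * Maps close to the identity and the inverse function theorem *)

Lemma near_diff (R : realType) (V W : normedModType R) (f : V -> W) (x : V) :
  differentiable f x ->
  forall e : R, 0 < e ->
    \forall y \near x, `|f y - f x - 'd f x (y - x)| <= e * `|y - x|.
Proof.
move=> /diffP[_ dfx] e e0; rewrite lim_id // in dfx.
have /eqaddoP/(_ _ e0) := funext dfx.
by apply: filterS => y; rewrite !fctE opprD addrA.
Qed.

Lemma near_differentiable (R : realType) (V W : normedModType R) (f : V -> W)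
    (x : V) (df : {linear V -> W}) :
  continuous df ->
  (forall e : R, 0 < e ->
    \forall y \near x, `|f y - f x - df (y - x)| <= e * `|y - x|) ->
  differentiable f x.
Proof.
move=> dfc fdf; apply/diffP.
apply: (@getPex _ (fun df : {linear V -> W} => continuous df /\
  forall y, f y = f (lim (nbhs x)) + df (y - lim (nbhs x))
                  +o_(y \near x) (y - lim (nbhs x)))).
exists df; split=> //; rewrite lim_id //.
suff h : f = (fun y => f x + df (y - x)) +o_ (nbhs x) (fun y => y - x).
  by move=> y; rewrite [in LHS]h.
apply/eqaddoP => e e0.
by apply: filterS (fdf _ e0) => y; rewrite !fctE opprD addrA.
Qed.

(** Solving g w = y amounts to finding a fixed point of w |-> w + (y - g w),
    whose increments are those of id - g.  It is therefore a contraction of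
    ratio 1/2, and it maps the closed ball of radius s about u into itself
    because it moves u by at most s / 2. *)
Lemma half_isometry_onto (R : realType) (E : normedModType R)
    (g : E -> E) (u y : E) (s : R) :
  complete_space E ->
  (forall v w, `|v - u| <= s -> `|w - u| <= s ->
     `|g v - g w - (v - w)| <= 2^-1 * `|v - w|) ->
  `|y - g u| <= 2^-1 * s ->
  exists2 w, `|w - u| <= s & g w = y.
Proof.
move=> cE gE yu.
have s0 : 0 <= s by have := le_trans (normr_ge0 _) yu; rewrite pmulr_rge0.
pose C := [set w | `|w - u| <= s].
pose f w := w + (y - g w).
have fC : {homo f : w / C w >-> C w}.
  move=> w Cw; rewrite /C /= (_ : f w - u = (y - g u) - (g w - g u - (w - u))).
    apply: le_trans (ler_normB _ _) _.
    rewrite [leRHS](splitr s) ![s / 2]mulrC lerD//.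
    apply: le_trans (gE _ _ Cw _) _; first by rewrite subrr normr0.
    by rewrite ler_wpM2l.
  by rewrite /f !opprB [w - u + _]addrC [RHS]addrA subrKA addrAC addrC.
have ctr : is_contraction (mkfun_fun fC).
  exists (2^-1)%:nng; split; first by rewrite /= invf_lt1 // ltr1n.
  move=> [v w] /= [Cv Cw].
  have -> : mkfun_fun fC v - mkfun_fun fC w = - (g v - g w - (v - w)).
    rewrite /mkfun_fun /= /mkfun /f opprD addrACA opprB.
    by rewrite [y - _ + _]addrC subrKA !opprB.
  by rewrite normrN; exact: gE.
have [||w Cw fw] := banach_fixed_point_complete cE ctr.
- rewrite (_ : C = closed_ball_ Num.norm u s); first exact: closed_closed_ball_.
  by apply/seteqP; split => w; rewrite /C /closed_ball_ /= distrC.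
- by exists u; rewrite /C /= subrr normr0.
exists w => //; move/eqP: fw; rewrite /mkfun_fun /= /mkfun /f.
by rewrite addrC -subr_eq subrr eq_sym subr_eq0 => /eqP.
Qed.

Lemma lipschitz_linear_continuous (R : realType) (V W : normedModType R)
    (f : {linear V -> W}) (c : R) :
  (forall x, `|f x| <= c * `|x|) -> continuous f.
Proof.
move=> fc; apply: bounded_linear_continuous; apply/linear_boundedP.
have := nbhs_pinfty_ge (num_real c); apply: filterS => r cr x.
by apply: le_trans (fc x) _; rewrite ler_wpM2r.
Qed.

(** The half-Lipschitz bound on g - id passes to the derivative: both bounds
    on g (u + t h) - g u are divided by t, with t small. *)
Lemma diff_half_isometry (R : realType) (E : normedModType R)
    (g : E -> E) (u : E) :
  differentiable g u ->
  (\forall v \near u, `|g v - g u - (v - u)| <= 2^-1 * `|v - u|) ->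
  forall h, `|'d g u h - h| <= 2^-1 * `|h|.
Proof.
move=> dg gu h.
have [->|h0] := eqVneq h 0; first by rewrite linear0 subrr normr0 mulr0.
have {}h0 : 0 < `|h| by rewrite normr_gt0.
apply/ler_addgt0Pr => e e0.
have cu : u + t *: h @[t --> (0:R)^'+] --> u.
  rewrite -[X in _ --> X]addr0 -(scale0r h); apply: cvgD; first exact: cvg_cst.
  by apply: cvgZl; apply: cvg_at_right_filter; exact: cvg_id.
have ge := near_diff dg (divr_gt0 e0 h0).
have uE t : u + t *: h - u = t *: h by rewrite addrC addKr.
have h1 : \forall t \near (0 : R)^'+,
    `|g (u + t *: h) - g u - (u + t *: h - u)| <= 2^-1 * `|u + t *: h - u|.
  exact: cu _ gu.
have h2 : \forall t \near (0 : R)^'+,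
    `|g (u + t *: h) - g u - 'd g u (u + t *: h - u)|
      <= e / `|h| * `|u + t *: h - u|.
  exact: cu _ ge.
near (0:R)^'+ => t.
have t0 : 0 < t by [].
have h1t : `|g (u + t *: h) - g u - (u + t *: h - u)|
  <= 2^-1 * `|u + t *: h - u| by near: t.
have h2t : `|g (u + t *: h) - g u - 'd g u (u + t *: h - u)|
  <= e / `|h| * `|u + t *: h - u| by near: t.
rewrite uE in h1t h2t.
rewrite -(ler_pM2l t0) -{1}[t]gtr0_norm// -normrZ scalerBr -linearZ.
rewrite -(subrKA (g (u + t *: h) - g u)) addrC.
apply: le_trans (ler_normD _ _) _; rewrite mulrDr.
apply: lerD.
  by apply: le_trans h1t _; rewrite normrZ gtr0_norm// mulrCA.
rewrite distrC; apply: le_trans h2t _.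
by rewrite normrZ gtr0_norm// mulrCA divfK ?gt_eqF.
Unshelve. all: by end_near. Qed.

Lemma half_isometry_norm (R : realType) (E : normedModType R) (a b : E) :
  `|b - a| <= 2^-1 * `|a| -> `|a| <= 2 * `|b|.
Proof.
move=> ab; have := ler_normD b (a - b).
rewrite subrKC [X in _ <= _ + X]distrC => /le_trans/(_ (lerD (lexx _) ab)).
move: `|a| `|b| => x y; lra.
Qed.

(** A linear map within 1/2 of the identity satisfies the hypothesis of
    half_isometry_onto on every ball, so it is onto; it is injective because
    it shrinks distances at most by half. *)
Lemma half_isometry_linear_inverse (R : realType) (E : normedModType R)
    (D : {linear E -> E}) :
  complete_space E -> (forall h, `|D h - h| <= 2^-1 * `|h|) ->
  exists2 C : {linear E -> E}, continuous C & cancel C D /\ cancel D C.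
Proof.
move=> cE DE.
have DN h : `|h| <= 2 * `|D h| by exact: half_isometry_norm.
have Dinj : injective D.
  move=> a b ab; apply/eqP; rewrite -subr_eq0 -normr_le0.
  by rewrite (le_trans (DN _))// linearB ab subrr normr0 mulr0.
have /choice[c DcE] : forall k, exists h, D h = k.
  move=> k; have [||h _ hk] := @half_isometry_onto _ _ D 0 k (2 * `|k|) cE.
  - by move=> v w _ _; rewrite -linearB.
  - by rewrite linear0 subr0 mulrA mulVf// mul1r.
  by exists h.
have clin : linear c.
  by move=> a v w; apply: Dinj; rewrite linearP !DcE.
pose C : {linear E -> E} := HB.pack c (GRing.isLinear.Build _ _ _ _ c clin).
exists C; last by split=> h; [exact: DcE | apply: Dinj; exact: DcE].
apply: (@lipschitz_linear_continuous _ _ _ _ 2) => h.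
by rewrite -{2}(DcE h); exact: DN.
Qed.

(** On the ball, g shrinks distances at most by half, so it is injective with
    a 2-Lipschitz inverse G, and half_isometry_onto on smaller balls makes the
    image open.  At g u the derivative of G is the inverse C of 'd g u: for
    y = g v, the error v - u - C (y - g u) is minus C of the first-order error
    of g, which is o(|v - u|), hence o(|y - g u|) by the Lipschitz bound. *)
Lemma half_isometry_local_inverse (R : realType) (E : normedModType R)
    (g : E -> E) (x : E) (r : R) :
  complete_space E ->
  (forall u v, ball x r u -> ball x r v ->
     `|g u - g v - (u - v)| <= 2^-1 * `|u - v|) ->
  (forall u, ball x r u -> differentiable g u) ->
  open (g @` ball x r) /\
  exists G : E -> E,
    forall u, ball x r u -> G (g u) = u /\ differentiable G (g u).
Proof.
move=> cE gE dg.
have ballE u : ball x r u = (`|u - x| < r) by rewrite -ball_normE /= distrC.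
have openB : open (g @` ball x r).
  rewrite openE => _ [u Bu <-]; apply/nbhs_ballP.
  pose s := (r - `|u - x|) / 2.
  have s0 : 0 < s by rewrite divr_gt0// subr_gt0 -ballE.
  have sB v : `|v - u| <= s -> ball x r v.
    rewrite ballE in Bu; rewrite ballE => vu.
    rewrite -(subrKA u) (le_lt_trans (ler_normD _ _))//.
    move: vu Bu; rewrite /s; move: `|v - u| `|u - x| => a b; lra.
  exists (2^-1 * s) => [|y]; first by rewrite /= mulr_gt0.
  rewrite -ball_normE /= distrC => /ltW yu.
  have [|w wu <-] := half_isometry_onto cE _ yu.
    by move=> v w vs ws; apply: gE; exact: sB.
  by exists w => //=; have := sB _ wu; rewrite ballE distrC.
have gN u v : ball x r u -> ball x r v -> `|u - v| <= 2 * `|g u - g v|.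
  by move=> Bu Bv; apply: half_isometry_norm; exact: gE.
pose G y := xget x [set u | ball x r u /\ g u = y].
have GK u : ball x r u -> G (g u) = u.
  move=> Bu; have [BG gG] : ball x r (G (g u)) /\ g (G (g u)) = g u.
    by apply: (@xgetPex _ x [set v | ball x r v /\ g v = g u]); exists u.
  apply/eqP; rewrite -subr_eq0 -normr_le0 (le_trans (gN _ _ BG Bu))//.
  by rewrite gG subrr normr0 mulr0.
split=> //; exists G => u Bu; split; first exact: GK.
have [C Cc [CK DK]] : exists2 C : {linear E -> E},
    continuous C & cancel C ('d g u) /\ cancel ('d g u) C.
  apply: half_isometry_linear_inverse => //.
  apply: diff_half_isometry; first exact: dg.
  have : \forall v \near u, ball x r v.
    by apply: open_nbhs_nbhs; split => //; exact: ball_open.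
  by apply: filterS => v Bv; exact: gE.
have [c c0 Cle] := linear_lipschitz Cc.
apply: (near_differentiable Cc) => e e0.
have e'0 : 0 < e / (2 * c) by rewrite divr_gt0// mulr_gt0.
have /nbhs_ballP[d /= d0 dsub] := near_diff (dg _ Bu) e'0.
have nB : \forall y \near g u, (g @` ball x r) y.
  by apply: open_nbhs_nbhs; split => //; exists u.
near=> y.
have [v Bv vy] : (g @` ball x r) y by near: y.
have yd : ball (g u) (d / 2) y by near: y; apply: nbhsx_ballx; rewrite divr_gt0.
rewrite -vy !GK// vy.
have vu : `|v - u| <= 2 * `|y - g u| by rewrite -vy; exact: gN.
have /dsub/= vd : ball u d v.
  rewrite -ball_normE /= distrC (le_lt_trans vu)//.
  by rewrite mulrC -ltr_pdivlMr// distrC; move: yd; rewrite -ball_normE.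
rewrite -normrN opprB -(DK (v - u)) -linearB.
apply: le_trans (Cle _) _; rewrite -vy.
apply: le_trans (ler_wpM2l (ltW c0) vd) _.
apply: le_trans (ler_wpM2l (ltW c0) (ler_wpM2l (ltW e'0) vu)) _.
by rewrite -vy (_ : c * _ = e * `|g v - g u|)//; field; rewrite gt_eqF.
Unshelve. all: by end_near. Qed.

(** * Mean values and the symmetry of second derivatives *)

Lemma derive_line (R : realType) (V : normedModType R) (f : V -> R) (x v : V)
    (t : R) : differentiable f (x + t *: v) ->
  is_derive t 1 (fun s => f (x + s *: v)) ('D_v f (x + t *: v)).
Proof.
move=> dfx; have {}dfx : derivable f (x + t *: v) v by exact: diff_derivable.
have E : (fun h : R => h^-1 *: (f (x + (h *: 1 + t) *: v) - f (x + t *: v)))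
       = (fun h => h^-1 *: (f (h *: v + (x + t *: v)) - f (x + t *: v))).
  apply/funext => h; congr (_ *: (f _ - _)).
  by rewrite [_ *: 1]mulr1 scalerDl addrCA.
by split; rewrite /derivable /derive /= E.
Qed.

Lemma mean_value_dir (R : realType) (V : normedModType R) (f : V -> R)
    (x v : V) : (forall y, differentiable f y) ->
  exists2 c : R, 0 <= c <= 1 & f (x + v) - f x = 'D_v f (x + c *: v).
Proof.
move=> df; have [] := @MVT R (fun s => f (x + s *: v))
  (fun s => 'D_v f (x + s *: v)) 0 1 ltr01.
- by move=> s _; exact: derive_line.
- apply: continuous_subspaceT => s; apply: differentiable_continuous.
  by apply/derivable1_diffP; have [] := derive_line (df (x + s *: v)).
move=> c; rewrite in_itv /= => /andP[c0 c1].
rewrite scale1r scale0r addr0 subr0 mulr1 => ->.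
by exists c => //; rewrite !ltW.
Qed.

Lemma derive_translate (R : realType) (V W : normedModType R) (f : V -> W)
    (x u v : V) : 'D_u (fun z => f (z + v)) x = 'D_u f (x + v).
Proof.
rewrite /derive /=; set F := fun h : R => _; set G := fun h : R => _.
by rewrite (_ : F = G)//; apply/funext => h; rewrite /F /G addrA.
Qed.

(** Two mean values in a row: first for y |-> f (y + v) - f y along u, then for
    'D_u f along v. *)
Lemma second_difference (R : realType) (V : normedModType R) (f : V -> R)
    (x u v : V) : Ck 2 f ->
  exists a b : R, [/\ 0 <= a <= 1, 0 <= b <= 1 &
    f (x + u + v) - f (x + u) - (f (x + v) - f x)
      = 'D_v ('D_u f) (x + a *: u + b *: v)].
Proof.
move=> [df /(_ u)[ddf _]].
pose F y := f (y + v) - f y.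
have dfv y : differentiable (fun z => f (z + v)) y.
  by apply: (@differentiable_comp _ _ _ _ (fun z => z + v) f).
have dF y : differentiable F y by apply: differentiableB.
have [a a01 Fa] := mean_value_dir x u dF.
have [b b01 fb] := mean_value_dir (x + a *: u) v ddf.
exists a, b; split => //; rewrite -fb.
rewrite [LHS](_ : _ = F (x + u) - F x)// Fa.
have -> : 'D_u F (x + a *: u) = 'D_u (fun z => f (z + v)) (x + a *: u)
   - 'D_u f (x + a *: u).
  by apply: deriveB; exact: diff_derivable.
by rewrite derive_translate.
Qed.

Lemma derive_scale_dir (R : realType) (V W : normedModType R) (f : V -> W)
    (x v : V) (s : R) : differentiable f x -> 'D_(s *: v) f x = s *: 'D_v f x.
Proof. by move=> df; rewrite !deriveE// linearZ. Qed.

(** The second difference of f over the parallelogram spanned by s u and s v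
    is symmetric in u and v.  By second_difference it equals s^2 times either
    mixed derivative at a point near x, so continuity at x forces the two
    derivatives to agree. *)
Lemma derive_comm (R : realType) (V : normedModType R) (f : V -> R)
    (x u v : V) : Ck 2 f -> 'D_v ('D_u f) x = 'D_u ('D_v f) x.
Proof.
move=> f2; have [df ddf] := f2.
have dd w y : differentiable ('D_w f) y by have [] := ddf w.
have cc w z : continuous ('D_w ('D_z f)) by have [_] := ddf z; apply.
have scale w z (s : R) y : 'D_(s *: w) ('D_(s *: z) f) y
    = s ^+ 2 * 'D_w ('D_z f) y.
  have -> : 'D_(s *: z) f = s *: 'D_z f.
    by apply/funext => a; exact: derive_scale_dir.
  rewrite (derive_scale_dir _ _ (differentiableZ s (dd z y))).
  have dz : derivable ('D_z f) y w by exact: diff_derivable.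
  by rewrite (deriveZ s dz) expr2 -mulrA.
apply/eqP; rewrite -subr_eq0 -normr_le0; apply/ler_addgt0Pr => e e0.
rewrite add0r.
have e20 : 0 < e / 2 by rewrite divr_gt0.
have /cvgrPdist_lt/(_ _ e20)/nbhs_ballP[d1 /= d10 c1] := cc v u x.
have /cvgrPdist_lt/(_ _ e20)/nbhs_ballP[d2 /= d20 c2] := cc u v x.
pose d := Num.min d1 d2.
have d0 : 0 < d by rewrite lt_min d10.
(* The 1 only keeps the denominator positive when u = v = 0. *)
pose s := d / (`|u| + `|v| + 1).
have k0 : 0 < `|u| + `|v| + 1 by rewrite ltr_wpDl// addr_ge0.
have s0 : 0 < s by rewrite divr_gt0.
have near_x a b y z : 0 <= a <= 1 -> 0 <= b <= 1 -> `|y| + `|z| = `|u| + `|v| ->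
    ball x d (x + a *: (s *: y) + b *: (s *: z)).
  move=> /andP[a0 a1] /andP[b0 b1] yz.
  rewrite -ball_normE /= -addrA opprD addNKr normrN.
  apply: le_lt_trans (ler_normD _ _) _.
  rewrite !normrZ !ger0_norm ?(ltW s0) ?(ltW d0)//.
  have sk : s * (`|u| + `|v| + 1) = d by rewrite /s divfK// gt_eqF.
  have ay : a * (s * `|y|) <= s * `|y| by rewrite ler_piMl// mulr_ge0// ltW.
  have bz : b * (s * `|z|) <= s * `|z| by rewrite ler_piMl// mulr_ge0// ltW.
  apply: le_lt_trans (lerD ay bz) _.
  by rewrite -mulrDr yz -sk ltr_pM2l// ltrDl.
have near_eq (A B p q : R) : p = q -> `|B - q| < e / 2 -> `|A - p| < e / 2 ->
    `|A - B| <= e.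
  move=> -> Bq Ap; rewrite distrC in Bq; apply: ltW; rewrite -(subrKA q).
  by rewrite (le_lt_trans (ler_normD _ _))// [ltRHS]splitr ltrD.
have swap (A B C D : R) : A - B - (C - D) = A - C - (B - D) by ring.
have s20 : s ^+ 2 != 0 by rewrite expf_neq0// gt_eqF.
have vu : `|v| + `|u| = `|u| + `|v| by exact: addrC.
have dd1 : d <= d1 by rewrite ge_min lexx.
have dd2 : d <= d2 by rewrite ge_min lexx orbT.
have [a [b [a01 b01 h1]]] := second_difference x (s *: u) (s *: v) f2.
have [a' [b' [a'01 b'01 h2]]] := second_difference x (s *: v) (s *: u) f2.
rewrite scale in h1; rewrite scale in h2.
have d1x := c1 _ (le_ball dd1 (near_x a b u v a01 b01 erefl)).
have d2x := c2 _ (le_ball dd2 (near_x a' b' v u a'01 b'01 vu)).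
apply: (near_eq _ _ _ _ (mulfI s20 _) d2x d1x).
apply: etrans (esym h1) _; apply: etrans _ h2.
by rewrite (addrAC x); exact: swap.
Qed.

(** * Strict differentiability of C^1 maps *)

(** A finite spanning family with coefficients bounded by the norm: all that
    the estimates below take from finite dimension, in a form that passes to
    products. *)
Definition has_coordinates (R : realType) (E : normedModType R) : Prop :=
  exists (I : finType) (e : I -> E) (l : E -> I -> R),
    forall h, h = \sum_i l h i *: e i /\ forall i, `|l h i| <= `|h|.

Lemma has_coordinates_real (R : realType) :
  has_coordinates (R : normedModType R).
Proof.
exists unit, (fun=> 1), (fun h _ => h) => h; split => //.
by rewrite big_const card_unit /= addr0 [_ *: _]mulr1.
Qed.

Lemma norm_row_coord (R : realType) (n : nat) (h : 'rV[R]_n) (i : 'I_n) :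
  `|h 0 i| <= `|h|.
Proof.
rewrite [leRHS]/Num.norm /= mx_normrE.
exact: (@le_bigmax _ _ _ 0 (fun ij : 'I_1 * 'I_n => `|h ij.1 ij.2|) (0, i)).
Qed.

Lemma has_coordinates_row (R : realType) (n : nat) : has_coordinates 'rV[R]_n.
Proof.
exists 'I_n, (fun j => delta_mx 0 j), (fun (h : 'rV[R]_n) j => h 0 j) => h.
split.
  exact: row_sum_delta.
by move=> i; exact: norm_row_coord.
Qed.

Lemma has_coordinates_prod (R : realType) (E F : normedModType R) :
  has_coordinates E -> has_coordinates F -> has_coordinates (E * F)%type.
Proof.
move=> [I [e [l lE]]] [J [f [m mE]]].
exists (I + J)%type,
  (fun k => match k with inl i => (e i, 0) | inr j => (0, f j) end),
  (fun h k => match k with inl i => l h.1 i | inr j => m h.2 j end) => h.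
split; last first.
  rewrite prod_normE => -[i|j]; rewrite le_max.
    by rewrite (lE h.1).2.
  by rewrite (mE h.2).2 orbT.
rewrite big_sumType /=; apply: injective_projections => /=; rewrite !raddf_sum.
  rewrite [X in _ + X]big1 => [|j _]; last by rewrite /= scaler0.
  by rewrite addr0 [LHS](lE h.1).1.
rewrite [X in X + _]big1 => [|i _]; last by rewrite /= scaler0.
by rewrite add0r [LHS](mE h.2).1.
Qed.

Lemma has_coordinates_continuous (R : realType) (E F : normedModType R)
    (f : {linear E -> F}) : has_coordinates E -> continuous f.
Proof.
move=> [I [e [l lE]]].
apply: (@lipschitz_linear_continuous _ _ _ f (\sum_i `|f (e i)|)) => h.
rewrite {1}(lE h).1 linear_sum (le_trans (ler_norm_sum _ _ _))// mulr_suml.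
apply: ler_sum => i _; rewrite linearZ normrZ mulrC ler_wpM2l//.
exact: (lE h).2.
Qed.

(** Differentiability with both endpoints of the increment moving: it is the
    estimate that makes the inverse function theorem a contraction argument,
    and unlike continuity of the differential it refers to no norm on linear
    maps. *)
Definition strict_diff (R : realType) (E F : normedModType R) (f df : E -> F)
    (x : E) : Prop :=
  forall e : R, 0 < e -> \forall p \near (x, x),
    `|f p.1 - f p.2 - df (p.1 - p.2)| <= e * `|p.1 - p.2|.

Lemma strict_diff_pair (R : realType) (E F G : normedModType R)
    (f df : E -> F) (g dg : E -> G) (x : E) :
  strict_diff f df x -> strict_diff g dg x ->
  strict_diff (fun y => (f y, g y)) (fun h => (df h, dg h)) x.
Proof.
move=> fx gx e e0; apply: filterS2 (fx e e0) (gx e e0) => p fp gp.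
by rewrite prod_normE ge_max fp.
Qed.

Lemma strict_diff_row (R : realType) (E : normedModType R) (n : nat)
    (f df : 'I_n -> E -> R) (x : E) :
  (forall j, strict_diff (f j) (df j) x) ->
  strict_diff (fun y => \row_j f j y) (fun h => \row_j df j h) x.
Proof.
move=> fx e e0; have : \forall p \near (x, x), forall j,
    `|f j p.1 - f j p.2 - df j (p.1 - p.2)| <= e * `|p.1 - p.2|.
  apply: (@filter_forall _ _ (fun j (p : E * E) => is_true (
    `|f j p.1 - f j p.2 - df j (p.1 - p.2)| <= e * `|p.1 - p.2|))
    _ (nbhs_filter (x, x))) => j.
  exact: fx.
apply: filterS => p fp; rewrite [leLHS]/Num.norm /= mx_normrE.
apply/bigmax_leP; split; first by rewrite mulr_ge0// ltW.
by move=> [i j] _; rewrite /= !mxE; exact: fp.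
Qed.

Lemma strict_diff_linear (R : realType) (E F : normedModType R)
    (f : {linear E -> F}) (x : E) : strict_diff f f x.
Proof.
move=> e e0; apply: (@filterE _ _ (nbhs_filter (x, x))) => p.
by rewrite linearB subrr normr0 mulr_ge0// ltW.
Qed.

Lemma strict_diff_near (R : realType) (E F : normedModType R) (f df : E -> F)
    (x : E) : strict_diff f df x -> forall e : R, 0 < e ->
  \forall y \near x, `|f y - f x - df (y - x)| <= e * `|y - x|.
Proof.
move=> fx e e0; have /nbhs_ballP[d /= d0 dsub] := fx e e0.
apply/nbhs_ballP; exists d => //= y xy.
by apply: (dsub (y, x)); split => //=; exact: ballxx.
Qed.

Lemma strict_diff_differentiable (R : realType) (E F : normedModType R)
    (f : E -> F) (df : {linear E -> F}) (x : E) :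
  continuous df -> strict_diff f df x -> differentiable f x.
Proof.
by move=> dfc fx; apply: near_differentiable dfc (strict_diff_near fx).
Qed.

(** An increment of f is a directional derivative at an intermediate point,
    and expands over the spanning family; each of the finitely many partial
    derivatives varies little near x. *)
Lemma C1_strict_diff (R : realType) (E : normedModType R) (f : E -> R) (x : E) :
  has_coordinates E -> Ck 1 f -> strict_diff f ('d f x) x.
Proof.
move=> [I [b [l lE]]] [df cf] e e0.
have e'0 : 0 < e / (#|I|%:R + 1) by rewrite divr_gt0// ltr_wpDl.
have /nbhs_ballP[d /= d0 dsub] : \forall y \near x, forall i,
    `|'D_(b i) f x - 'D_(b i) f y| < e / (#|I|%:R + 1).
  apply: (@filter_forall _ _ (fun i y =>
    `|'D_(b i) f x - 'D_(b i) f y| < e / (#|I|%:R + 1))) => i.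
  by move: (cf (b i) x) => /cvgrPdist_lt; apply.
apply/nbhs_ballP; exists d => //= -[u v] [/= xu xv].
have [c /andP[c0 c1]] := mean_value_dir v (u - v) df.
rewrite subrKC => ->; rewrite deriveE//.
have /dsub/= cy : ball x d (v + c *: (u - v)).
  rewrite -ball_normE /= in xu; rewrite -ball_normE /= in xv.
  rewrite -ball_normE /=.
  have -> : x - (v + c *: (u - v)) = c *: (x - u) + (1 - c) *: (x - v).
    rewrite scalerBl scale1r addrCA -scalerBr (opprB x v) [_ + (v - x)]addrC.
    by rewrite subrKA opprD addrA -scalerN opprB.
  apply: le_lt_trans (ler_normD _ _) _; rewrite !normrZ !ger0_norm ?subr_ge0//.
  apply: (@le_lt_trans _ _ (Num.max `|x - u| `|x - v|)); last first.
    by rewrite gt_max xu.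
  set m := Num.max _ _.
  have um : `|x - u| <= m by rewrite le_max lexx.
  have vm : `|x - v| <= m by rewrite le_max lexx orbT.
  have c1' : 0 <= 1 - c by rewrite subr_ge0.
  apply: le_trans (lerD (ler_wpM2l c0 um) (ler_wpM2l c1' vm)) _.
  by rewrite -mulrDl subrKC mul1r.
have dE y : 'd f y (u - v) = \sum_i l (u - v) i *: 'D_(b i) f y.
  rewrite {1}(lE (u - v)).1 linear_sum.
  by apply: eq_bigr => i _; rewrite linearZ deriveE.
rewrite !dE -sumrB.
apply: le_trans (ler_norm_sum _ _ _) _.
apply: (@le_trans _ _ (\sum_(i : I) e / (#|I|%:R + 1) * `|u - v|)).
  apply: ler_sum => i _; rewrite -scalerBr normrZ mulrC.
  by rewrite ler_pM// ?(lE _).2// distrC ltW.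
rewrite sumr_const -[leLHS]mulr_natl mulrA ler_wpM2r//.
rewrite mulrA [_ * e]mulrC -mulrA ler_piMr ?ltW// ltr_pdivrMr ?ltr_wpDl//.
by rewrite mul1r ltrDl.
Qed.

(** Composing F with the inverse of its derivative at x gives a map whose
    difference with the identity is as Lipschitz-small as wanted near x, to
    which half_isometry_local_inverse applies. *)
Theorem inverse_function (R : realType) (E : normedModType R)
    (F : E -> E) (dF : E -> {linear E -> E}) (B : {linear E -> E}) (x : E) :
  complete_space E -> has_coordinates E -> (forall y, strict_diff F (dF y) y) ->
  cancel (dF x) B -> cancel B (dF x) ->
  exists (U W : set E) (G : E -> E),
    [/\ U x, open U, open W, (forall u, U u -> W (F u) /\ G (F u) = u)
      & (forall y, W y -> [/\ U (G y), F (G y) = y & differentiable G y])].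
Proof.
move=> cE coordE FdF AK BK.
have linc (f : {linear E -> E}) : continuous f.
  exact: has_coordinates_continuous.
have diffF y : differentiable F y.
  exact: strict_diff_differentiable (linc _) (FdF y).
have [c c0 Ble] := linear_lipschitz (linc B).
have e0 : 0 < (2 * c)^-1 by rewrite invr_gt0 mulr_gt0.
have /nbhs_ballP[d /= d0 dsub] := FdF x _ e0.
pose g := B \o F.
have dB y : differentiable B y by exact: linear_differentiable.
have dg y : differentiable g y by apply: differentiable_comp.
have gE u v : ball x d u -> ball x d v ->
    `|g u - g v - (u - v)| <= 2^-1 * `|u - v|.
  move=> xu xv; have /dsub/= uv : ball (x, x) d (u, v) by [].
  rewrite -{1}(AK (u - v)) /g /= -!linearB.
  apply: le_trans (Ble _) _; apply: le_trans (ler_wpM2l (ltW c0) uv) _.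
  by rewrite invfM mulrA mulrCA mulfV ?mulr1// gt_eqF.
have [gopen [G0 G0P]] := half_isometry_local_inverse cE gE (fun u _ => dg u).
exists (ball x d), (B @^-1` (g @` ball x d)), (G0 \o B); split.
- exact: ballxx.
- exact: ball_open.
- by apply: open_comp => // y _; exact: linc.
- move=> u xu; split; first by exists u.
  by have [] := G0P u xu.
- move=> y [u xu guy]; have [G0u dG0] := G0P u xu.
  rewrite /= -guy G0u; split => //.
    by rewrite -[LHS]BK -[B _]/(g u) guy BK.
  by apply: differentiable_comp; rewrite // -guy.
Qed.

(** * Derivatives of composites on product spaces *)

Lemma is_derive_diff_comp (R : realType) (V W Z : normedModType R)
    (f : W -> Z) (g dg : V -> W) (x v : V) :
  is_diff x g dg -> differentiable f (g x) ->
  is_derive x v (fun y => f (g y)) ('d f (g x) (dg v)).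
Proof.
move=> gx df.
have dfg : differentiable (f \o g) x by exact: differentiable_comp.
split; first exact: diff_derivable.
by rewrite deriveE// diff_comp//= diff_val.
Qed.

Lemma is_derive_linear_comp (R : realType) (V W Z : normedModType R)
    (f : {linear W -> Z}) (g : V -> W) (x v : V) :
  has_coordinates W -> differentiable g x ->
  is_derive x v (fun y => f (g y)) (f ('d g x v)).
Proof.
move=> cW dg; have fc : continuous f by exact: has_coordinates_continuous.
have df : differentiable f (g x) by exact: linear_differentiable.
by have := is_derive_diff_comp v (differentiableP dg) df; rewrite diff_lin.
Qed.

Lemma is_diff_fst_snd (R : realType) (Q M T : normedModType R)
    (y : Q * M * T) :
  is_diff y (fun z : Q * M * T => z.1.2) (fun z => z.1.2).
Proof.
pose f : {linear (Q * M * T)%type -> M} := snd \o fst.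
have fc : continuous f.
  move=> p; apply: (@continuous_comp _ _ _ fst snd); first exact: cvg_fst.
  exact: cvg_snd.
split; first exact: (@linear_differentiable _ _ _ f).
exact: (@diff_lin _ _ _ f).
Qed.

Lemma differentiable_fst_snd (R : realType) (V A B C : normedModType R)
    (G : V -> A * B * C) (y : V) :
  differentiable G y -> differentiable (fun z => (G z).1.2) y.
Proof.
move=> dG; have d2 := @ex_diff _ _ _ _ _ _ _ (is_diff_fst_snd (G y)).
exact: (differentiable_comp dG d2).
Qed.

Lemma is_derive_subst_middle (R : realType) (Q M T : normedModType R)
    (L : Q * M * T -> R) (V : Q * M * T -> M) (y h : Q * M * T) :
  differentiable V y -> differentiable L (y.1.1, V y, y.2) ->
  is_derive y h (fun z => L (z.1.1, V z, z.2))
    ('d L (y.1.1, V y, y.2) (h.1.1, 'd V y h, h.2)).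
Proof.
move=> dV dL.
have d1 : is_diff y (fun z : Q * M * T => z.1.1) (fun z => z.1.1).
  pose f : {linear (Q * M * T)%type -> Q} := fst \o fst.
  have fc : continuous f.
    by move=> p; apply: (@continuous_comp _ _ _ fst fst); exact: cvg_fst.
  split; first exact: (@linear_differentiable _ _ _ f).
  exact: (@diff_lin _ _ _ f).
have d2 : is_diff y (fun z : Q * M * T => z.2) (fun z => z.2).
  pose f : {linear (Q * M * T)%type -> T} := snd.
  have fc : continuous f by move=> p; exact: cvg_snd.
  split; first exact: (@linear_differentiable _ _ _ f).
  exact: (@diff_lin _ _ _ f).
have dVy := differentiableP dV.
have dg : is_diff y (fun z => (z.1.1, V z, z.2))
    (fun z => (z.1.1, 'd V y z, z.2)).
  exact: is_diff_pair.
exact: (is_derive_diff_comp h dg dL).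
Qed.

(** * Wirtinger derivatives of real functions *)

Local Open Scope complex_scope.

Lemma half_mulC (R : realType) (z : R[i]) :
  2^-1 * z = (2^-1 * complex.Re z) +i* (2^-1 * complex.Im z).
Proof.
have -> : (2^-1 : R[i]) = (2^-1)%:C by rewrite fmorphV rmorph_nat.
by case: z => a b; simpc.
Qed.

Lemma wirtE (R : realType) (V : normedModType R) (e : V * V) (f : V -> R[i])
    (x : V) :
  wirt e f x =
    (2^-1 * ('D_e.1 (fun y => complex.Re (f y)) x
             + 'D_e.2 (fun y => complex.Im (f y)) x)) +i*
    (2^-1 * ('D_e.1 (fun y => complex.Im (f y)) x
             - 'D_e.2 (fun y => complex.Re (f y)) x)).
Proof. by rewrite /wirt half_mulC /cderive; simpc. Qed.

Lemma wirtbarE (R : realType) (V : normedModType R) (e : V * V) (f : V -> R[i])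
    (x : V) :
  wirtbar e f x =
    (2^-1 * ('D_e.1 (fun y => complex.Re (f y)) x
             - 'D_e.2 (fun y => complex.Im (f y)) x)) +i*
    (2^-1 * ('D_e.1 (fun y => complex.Im (f y)) x
             + 'D_e.2 (fun y => complex.Re (f y)) x)).
Proof. by rewrite /wirtbar half_mulC /cderive; simpc. Qed.

Lemma wirt_real (R : realType) (V : normedModType R) (e : V * V) (f : V -> R)
    (x : V) :
  wirt e (fun y => (f y)%:C) x
    = (2^-1 * 'D_e.1 f x) +i* - (2^-1 * 'D_e.2 f x).
Proof. by rewrite wirtE /= !derive_cst addr0 sub0r mulrN. Qed.

Lemma wirtbar_real (R : realType) (V : normedModType R) (e : V * V) (f : V -> R)
    (x : V) :
  wirtbar e (fun y => (f y)%:C) x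
    = (2^-1 * 'D_e.1 f x) +i* (2^-1 * 'D_e.2 f x).
Proof. by rewrite wirtbarE /= !derive_cst subr0 add0r. Qed.

(** Up to factors and a sign, the momentum is the real gradient of L in the
    velocity, so its derivative in the velocity is, likewise, the real
    Hessian. *)
Lemma momentumE (R : realType) (d : nat) (L : phase R d -> R) (x : phase R d) :
  momentum L x = (\row_j (2^-1 * 'D_(dir_w R j).1 L x),
                  \row_j (- (2^-1 * 'D_(dir_w R j).2 L x))).
Proof.
by congr pair; apply/rowP => j; rewrite !mxE wirt_real.
Qed.

(** For d = 1 the blocks are scalars, hence commute, and the determinant of
    the block matrix is the opposite of the one in legendre_like. *)
Lemma momentum_jacobian_small (R : realType) (d : nat) (L : phase R d -> R) :
  legendre_like L -> (d <= 1)%N ->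
  forall x, \det (momentum_jacobian L x) != 0.
Proof.
case: d L => [|[|//]] L LL _ x; first by rewrite det_mx00 oner_neq0.
have := LL x; rewrite det_mx11 /momentum_jacobian.
rewrite (expand_det_row _ 0) !big_ord_recl big_ord0 addr0 /cofactor !det_mx11.
set a := L_vv L x; set b := L_vvbar L x; set c := L_vbarvbar L x.
set J := block_mx _ _ _ _.
have J00 : J 0 ord0 = a 0 0.
  by rewrite -(block_mxEul a b b^T c); congr (J _ _); apply: val_inj.
have J01 : J 0 (lift ord0 ord0) = b 0 0.
  by rewrite -(block_mxEur a b b^T c); congr (J _ _); apply: val_inj.
have J10 : J (lift 0 0) (lift (lift ord0 ord0) 0) = b 0 0.
  have <- : b^T 0 0 = b 0 0 by exact: mxE.
  rewrite -(block_mxEdl a b b^T c).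
  by congr (J _ _); apply: val_inj.
have J11 : J (lift 0 0) (lift ord0 0) = c 0 0.
  by rewrite -(block_mxEdr a b b^T c); congr (J _ _); apply: val_inj.
clearbody J a b c; rewrite !mxE !big_ord1 J00 J01 J10 J11.
rewrite /= expr0 expr1 mul1r mulN1r mulrN.
by rewrite -oppr_eq0 opprB.
Qed.

Lemma derive_scaled_derive (R : realType) (V : normedModType R) (f : V -> R)
    (x u v : V) (c : R) : Ck 2 f ->
  'D_u (fun y => c * 'D_v f y) x = c * 'D_u ('D_v f) x.
Proof.
by move=> [_ f1]; apply: deriveZ; apply: diff_derivable; exact: (f1 v).1.
Qed.

Lemma derive_opp_scaled_derive (R : realType) (V : normedModType R) (f : V -> R)
    (x u v : V) (c : R) : Ck 2 f ->
  'D_u (fun y => - (c * 'D_v f y)) x = - (c * 'D_u ('D_v f) x).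
Proof.
move=> f2; under eq_fun do rewrite -mulNr.
by rewrite derive_scaled_derive// mulNr.
Qed.

Lemma wirt_wirt_real (R : realType) (V : normedModType R) (e e' : V * V)
    (f : V -> R) (x : V) : Ck 2 f ->
  wirt e (wirt e' (fun y => (f y)%:C)) x =
    (4^-1 * ('D_e.1 ('D_e'.1 f) x - 'D_e.2 ('D_e'.2 f) x)) +i*
    (- (4^-1 * ('D_e.1 ('D_e'.2 f) x + 'D_e.2 ('D_e'.1 f) x))).
Proof.
move=> f2; rewrite (funext (wirt_real e' f)) wirtE /=.
rewrite !(derive_scaled_derive _ _ _ _ f2).
rewrite !(derive_opp_scaled_derive _ _ _ _ f2).
have collect (a b c g : R) :
    (2^-1 * (2^-1 * a + - (2^-1 * g))) +i* (2^-1 * (- (2^-1 * b) - 2^-1 * c))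
    = (4^-1 * (a - g)) -i* (4^-1 * (b + c)) by congr (_ +i* _); field.
exact: collect.
Qed.

Lemma wirt_wirtbar_real (R : realType) (V : normedModType R) (e e' : V * V)
    (f : V -> R) (x : V) : Ck 2 f ->
  wirt e (wirtbar e' (fun y => (f y)%:C)) x =
    (4^-1 * ('D_e.1 ('D_e'.1 f) x + 'D_e.2 ('D_e'.2 f) x)) +i*
    (4^-1 * ('D_e.1 ('D_e'.2 f) x - 'D_e.2 ('D_e'.1 f) x)).
Proof.
move=> f2; rewrite (funext (wirtbar_real e' f)) wirtE /=.
rewrite !(derive_scaled_derive _ _ _ _ f2).
have collect (a b c g : R) :
    (2^-1 * (2^-1 * a + 2^-1 * g)) +i* (2^-1 * (2^-1 * b - 2^-1 * c))
    = (4^-1 * (a + g)) +i* (4^-1 * (b - c)) by congr (_ +i* _); field.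
exact: collect.
Qed.

(** The lower left block of momentum_jacobian is the transpose of L_vvbar; its
    entries come with the two directions exchanged. *)
Lemma wirt_wirtbar_real_comm (R : realType) (V : normedModType R) (e e' : V * V)
    (f : V -> R) (x : V) : Ck 2 f ->
  wirt e (wirtbar e' (fun y => (f y)%:C)) x =
    (4^-1 * ('D_e'.1 ('D_e.1 f) x + 'D_e'.2 ('D_e.2 f) x)) +i*
    (4^-1 * ('D_e'.2 ('D_e.1 f) x - 'D_e'.1 ('D_e.2 f) x)).
Proof.
move=> f2; rewrite (wirt_wirtbar_real e e' x f2).
have swap (a b c g a' b' c' g' : R) : a = a' -> b = b' -> c = c' -> g = g' ->
    (4^-1 * (a + g)) +i* (4^-1 * (b - c))
    = (4^-1 * (a' + g')) +i* (4^-1 * (b' - c')) by move=> -> -> -> ->.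
exact: (swap _ _ _ _ _ _ _ _
  (derive_comm x e'.1 e.1 f2) (derive_comm x e'.2 e.1 f2)
  (derive_comm x e'.1 e.2 f2) (derive_comm x e'.2 e.2 f2)).
Qed.

Lemma wirtbar_wirtbar_real (R : realType) (V : normedModType R) (e e' : V * V)
    (f : V -> R) (x : V) : Ck 2 f ->
  wirtbar e (wirtbar e' (fun y => (f y)%:C)) x =
    (4^-1 * ('D_e.1 ('D_e'.1 f) x - 'D_e.2 ('D_e'.2 f) x)) +i*
    (4^-1 * ('D_e.1 ('D_e'.2 f) x + 'D_e.2 ('D_e'.1 f) x)).
Proof.
move=> f2; rewrite (funext (wirtbar_real e' f)) wirtbarE /=.
rewrite !(derive_scaled_derive _ _ _ _ f2).
have collect (a b c g : R) :
    (2^-1 * (2^-1 * a - 2^-1 * g)) +i* (2^-1 * (2^-1 * b + 2^-1 * c))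
    = (4^-1 * (a - g)) +i* (4^-1 * (b + c)) by congr (_ +i* _); field.
exact: collect.
Qed.

Lemma sum_complex (R : realType) (I : finType) (a b : I -> R) :
  \sum_i (a i +i* b i) = (\sum_i a i) +i* (\sum_i b i).
Proof. by elim/big_rec3: _ => //= i x y z _ ->; simpc. Qed.

Lemma sum_half_eq0 (R : realType) (I : finType) (a b : I -> R) :
  \sum_i a i = 0 -> \sum_i b i = 0 ->
  \sum_i ((2^-1 * a i) +i* (2^-1 * b i)) = 0.
Proof. by move=> a0 b0; rewrite sum_complex -!mulr_sumr a0 b0 !mulr0. Qed.

Lemma sum_half_conj_eq0 (R : realType) (I : finType) (a b : I -> R) :
  \sum_i a i = 0 -> \sum_i b i = 0 ->
  \sum_i ((2^-1 * a i) -i* (2^-1 * b i)) = 0.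
Proof.
by move=> a0 b0; rewrite sum_complex sumrN -!mulr_sumr a0 b0 !mulr0 oppr0.
Qed.

(** In this lemma and the next, a, b, c and g stand for the real second
    derivatives in the directions 11, 12, 21 and 22: these are the
    contributions of one index to the two halves of the product of the row of
    u + iv and u - iv with momentum_jacobian. *)
Lemma conj_row_anti (R : realType) (u v a b c g : R) :
  (u +i* v) * ((4^-1 * (a + g)) +i* (4^-1 * (b - c)))
  + (u -i* v) * ((4^-1 * (a - g)) +i* (4^-1 * (b + c)))
  = (2^-1 * (u * a + v * c)) +i* (2^-1 * (u * b + v * g)).
Proof. by simpc; congr (_ +i* _); field. Qed.

Lemma conj_row_holo (R : realType) (u v a b c g : R) :
  (u +i* v) * ((4^-1 * (a - g)) -i* (4^-1 * (b + c)))
  + (u -i* v) * ((4^-1 * (a + g)) +i* (4^-1 * (c - b)))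
  = (2^-1 * (u * a + v * c)) -i* (2^-1 * (u * b + v * g)).
Proof. by simpc; congr (_ +i* _); field. Qed.

(** If the real variation (u, v) of the velocity is killed by the real Hessian,
    then the row of u + iv followed by u - iv is killed by the complex matrix
    momentum_jacobian, because the combinations of real second derivatives
    occurring in that product are, up to sign, half those in the
    hypotheses. *)
Lemma hessian_injective (R : realType) (d : nat) (L : phase R d -> R)
    (x : phase R d) (u v : 'I_d -> R) :
  Ck 2 L -> \det (momentum_jacobian L x) != 0 ->
  (forall j, \sum_i (u i * 'D_(dir_w R i).1 ('D_(dir_w R j).1 L) x
                     + v i * 'D_(dir_w R i).2 ('D_(dir_w R j).1 L) x) = 0) ->
  (forall j, \sum_i (u i * 'D_(dir_w R i).1 ('D_(dir_w R j).2 L) x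
                     + v i * 'D_(dir_w R i).2 ('D_(dir_w R j).2 L) x) = 0) ->
  forall i, u i = 0 /\ v i = 0.
Proof.
move=> L2 detJ h1 h2.
pose e : 'rV[R[i]]_d := \row_i (u i +i* v i).
pose ebar : 'rV[R[i]]_d := \row_i (u i -i* v i).
have kerJ : row_mx e ebar *m momentum_jacobian L x = 0.
  rewrite /momentum_jacobian mul_row_block -row_mx0.
  congr row_mx; apply/rowP => j; rewrite !mxE -big_split /=.
    under eq_bigr => i _.
      rewrite !mxE (wirt_wirt_real _ _ _ L2) (wirt_wirtbar_real_comm _ _ _ L2).
      rewrite conj_row_holo.
      over.
    exact: (sum_half_conj_eq0 (h1 j) (h2 j)).
  under eq_bigr => i _.
    rewrite !mxE (wirt_wirtbar_real _ _ _ L2) (wirtbar_wirtbar_real _ _ _ L2).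
    rewrite conj_row_anti.
    over.
  exact: (sum_half_eq0 (h1 j) (h2 j)).
have unitJ : momentum_jacobian L x \in unitmx by rewrite unitmxE unitfE.
move: (congr1 (mulmx^~ (invmx (momentum_jacobian L x))) kerJ).
rewrite mulmxK// mul0mx -row_mx0 => /eq_row_mx[e0 _] i.
by move/rowP: e0 => /(_ i); rewrite !mxE => -[].
Qed.

(** * Local inversion of the Legendre map *)

Lemma C1_scaled_derive (R : realType) (V : normedModType R) (f : V -> R)
    (v : V) (c : R) : Ck 2 f -> Ck 1 (fun y => c * 'D_v f y).
Proof.
move=> f2; have [_ f1] := f2; split.
  by move=> y; apply: differentiableZ; exact: (f1 v).1.
move=> u; rewrite (funext (fun x => derive_scaled_derive x u v c f2)).
by move=> y; apply: cvgMr; exact: (f1 v).2.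
Qed.

Lemma has_coordinates_phase (R : realType) (d : nat) :
  has_coordinates (phase R d).
Proof.
apply: has_coordinates_prod; apply: has_coordinates_prod.
- by apply: has_coordinates_prod; exact: has_coordinates_row.
- by apply: has_coordinates_prod; exact: has_coordinates_row.
- exact: has_coordinates_real.
- exact: has_coordinates_real.
Qed.

Lemma complete_space_phase (R : realType) (d : nat) :
  complete_space (phase R d).
Proof.
apply: complete_space_prod; apply: complete_space_prod.
- by apply: complete_space_prod; exact: complete_space_row.
- by apply: complete_space_prod; exact: complete_space_row.
- exact: complete_space_real.
- exact: complete_space_real.
Qed.

Definition legendre_map (R : realType) (d : nat) (L : phase R d -> R)
    (x : phase R d) : phase R d := (x.1.1, momentum L x, x.2).

Definition legendre_diff (R : realType) (d : nat) (L : phase R d -> R)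
    (x h : phase R d) : phase R d :=
  (h.1.1,
   (\row_j 'd (fun y => 2^-1 * 'D_(dir_w R j).1 L y) x h,
    \row_j 'd (fun y => - 2^-1 * 'D_(dir_w R j).2 L y) x h),
   h.2).

Lemma legendre_diff_linear (R : realType) (d : nat) (L : phase R d -> R)
    (x : phase R d) : linear (legendre_diff L x).
Proof.
move=> a h k; rewrite /legendre_diff.
congr (_, _, _) => //; congr (_, _); apply/rowP => j; rewrite !mxE.
  exact: linearP.
exact: linearP.
Qed.

HB.instance Definition _ (R : realType) (d : nat) (L : phase R d -> R)
    (x : phase R d) :=
  GRing.isLinear.Build R (phase R d) (phase R d) _ (legendre_diff L x)
    (@legendre_diff_linear R d L x).

Lemma legendre_strict_diff (R : realType) (d : nat) (L : phase R d -> R)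
    (x : phase R d) :
  Ck 2 L -> strict_diff (legendre_map L) (legendre_diff L x) x.
Proof.
move=> L2.
have -> : legendre_map L = fun y => (y.1.1,
   (\row_j (2^-1 * 'D_(dir_w R j).1 L y),
    \row_j (- 2^-1 * 'D_(dir_w R j).2 L y)), y.2).
  apply/funext => y; rewrite /legendre_map momentumE.
  by congr (_, (_, _), _); apply/rowP => j; rewrite !mxE mulNr.
have partial v c : strict_diff (fun y => c * 'D_v L y)
    ('d (fun y => c * 'D_v L y) x) x.
  apply: C1_strict_diff; first exact: has_coordinates_phase.
  exact: C1_scaled_derive.
apply: (@strict_diff_pair _ _ _ _ (fun y : phase R d => (y.1.1, _))).
  apply: strict_diff_pair.
    exact: (@strict_diff_linear _ _ _
      (fst \o fst : {linear phase R d -> Cvec R d})).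
  by apply: strict_diff_pair; apply: strict_diff_row => j; exact: partial.
exact: (@strict_diff_linear _ _ _ (snd : {linear phase R d -> _})).
Qed.

Lemma velocity_sum (R : realType) (d : nat) (w : Cvec R d) :
  (((0, w), 0) : phase R d)
    = \sum_i (w.1 0 i *: (dir_w R i).1 + w.2 0 i *: (dir_w R i).2).
Proof.
case: w => a b; apply: injective_projections.
  apply: injective_projections; rewrite !raddf_sum /=.
    by rewrite big1// => i _; rewrite !scaler0 addr0.
  apply: injective_projections; rewrite !raddf_sum /= [LHS]row_sum_delta;
    by apply: eq_bigr => i _; rewrite scaler0 ?addr0 ?add0r.
rewrite !raddf_sum /= big1// => i _; rewrite !scaler0 addr0 //.
Qed.

Lemma diff_velocity (R : realType) (d : nat) (L : phase R d -> R)
    (x v : phase R d) (c : R) (w : Cvec R d) : Ck 2 L ->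
  'd (fun y => c * 'D_v L y) x ((0, w), 0)
  = c * \sum_i (w.1 0 i * 'D_(dir_w R i).1 ('D_v L) x
              + w.2 0 i * 'D_(dir_w R i).2 ('D_v L) x).
Proof.
move=> L2; have dc : differentiable (fun y => c * 'D_v L y) x.
  exact: (C1_scaled_derive v c L2).1.
rewrite velocity_sum linear_sum mulr_sumr; apply: eq_bigr => i _.
rewrite linearD !linearZ -!deriveE// !derive_scaled_derive//.
by rewrite mulrDr; congr (_ + _); exact: mulrCA.
Qed.

Lemma legendre_diff_injective (R : realType) (d : nat) (L : phase R d -> R)
    (x : phase R d) : Ck 2 L -> \det (momentum_jacobian L x) != 0 ->
  forall h, legendre_diff L x h = 0 -> h = 0.
Proof.
move=> L2 detJ [[q w] t] [q0 m1 m2 t0]; rewrite q0 t0 in m1 m2 *.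
have half0 : (2^-1 : R) != 0 by rewrite invr_eq0 pnatr_eq0.
have cancel_half (c : R) v : c != 0 ->
    'd (fun y => c * 'D_v L y) x ((0, w), 0) = 0 ->
    \sum_i (w.1 0 i * 'D_(dir_w R i).1 ('D_v L) x
            + w.2 0 i * 'D_(dir_w R i).2 ('D_v L) x) = 0.
  move=> c0; rewrite diff_velocity// => /eqP.
  by rewrite mulf_eq0 (negPf c0) => /eqP.
have w0 : forall i, w.1 0 i = 0 /\ w.2 0 i = 0.
  apply: (hessian_injective L2 detJ) => j.
    move/rowP: m1 => /(_ j); rewrite !mxE; exact: cancel_half.
  move/rowP: m2 => /(_ j); rewrite !mxE; apply: cancel_half.
  by rewrite oppr_eq0.
congr (_, _, _); apply: injective_projections; apply/rowP => i; rewrite mxE.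
  by rewrite (w0 i).1.
by rewrite (w0 i).2.
Qed.

(** By dimension, an injective endomorphism is onto. *)
Lemma injective_endo_inverse (K : fieldType) (vT : vectType K)
    (f : {linear vT -> vT}) : (forall h, f h = 0 -> h = 0) ->
  exists B : {linear vT -> vT}, cancel f B /\ cancel B f.
Proof.
move=> f0; pose A : 'End(vT) := linfun f.
have kerA : lker A == 0%VS.
  apply/lker0P => a b; rewrite !lfunE => /eqP.
  by rewrite -subr_eq0 -linearB => /eqP/f0/eqP; rewrite subr_eq0 => /eqP.
exists (A^-1%VF : {linear vT -> vT}); split => h.
  by have := lker0_lfunK kerA h; rewrite lfunE.
by have := lker0_lfunVK kerA h; rewrite lfunE.
Qed.

Lemma legendre_diff_inverse (R : realType) (d : nat) (L : phase R d -> R)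
    (x : phase R d) : Ck 2 L -> \det (momentum_jacobian L x) != 0 ->
  exists B : {linear phase R d -> phase R d},
    cancel (legendre_diff L x) B /\ cancel B (legendre_diff L x).
Proof.
move=> L2 detJ.
exact: (injective_endo_inverse (legendre_diff_injective L2 detJ)).
Qed.

Lemma local_inverse_exists (R : realType) (d : nat) (L : phase R d -> R)
    (x : phase R d) : Ck 2 L -> \det (momentum_jacobian L x) != 0 ->
  exists U W V, U x /\ local_inverse L U W V.
Proof.
move=> L2 detJ; have [B [AK BK]] := legendre_diff_inverse L2 detJ.
have [U [W [G [Ux Uo Wo UW WU]]]] :=
  inverse_function (@complete_space_phase R d) (has_coordinates_phase R d)
    (fun y => legendre_strict_diff y L2) AK BK.
exists U, W, (fun y => (G y).1.2); split => //; split => //.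
- move=> y /WU[_ _ dG].
  exact: differentiable_fst_snd dG.
- by move=> q v t /UW[]; rewrite /legendre_map /= => ? ->.
- move=> q p t /WU[]; rewrite /legendre_map.
  case: (G (q, p, t)) => [[q' v'] t'] /= UG [q'q mom t't] _.
  by subst q' t'.
Qed.

(** * Derivatives of the Hamiltonian *)

(** Twice the real part of the sum of the products p_j k_j. *)
Definition pairing (R : realType) (d : nat) (p k : Cvec R d) : R :=
  \sum_(j < d) 2 * (p.1 0 j * k.1 0 j - p.2 0 j * k.2 0 j).

Definition re_coord (R : realType) (d : nat) (j : 'I_d) (z : Cvec R d) : R :=
  z.1 0 j.

Definition im_coord (R : realType) (d : nat) (j : 'I_d) (z : Cvec R d) : R :=
  z.2 0 j.

Lemma re_coord_linear (R : realType) (d : nat) (j : 'I_d) :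
  linear (@re_coord R d j).
Proof. by move=> a u v; rewrite /re_coord !mxE. Qed.

Lemma im_coord_linear (R : realType) (d : nat) (j : 'I_d) :
  linear (@im_coord R d j).
Proof. by move=> a u v; rewrite /im_coord !mxE. Qed.

HB.instance Definition _ (R : realType) (d : nat) (j : 'I_d) :=
  GRing.isLinear.Build R (Cvec R d) R _ (@re_coord R d j)
    (@re_coord_linear R d j).

HB.instance Definition _ (R : realType) (d : nat) (j : 'I_d) :=
  GRing.isLinear.Build R (Cvec R d) R _ (@im_coord R d j)
    (@im_coord_linear R d j).

Lemma has_coordinates_Cvec (R : realType) (d : nat) :
  has_coordinates (Cvec R d).
Proof. by apply: has_coordinates_prod; exact: has_coordinates_row. Qed.

Lemma is_derive_pairing (R : realType) (d : nat) (V : normedModType R)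
    (p q dp dq : V -> Cvec R d) (y h : V) :
  is_diff y p dp -> is_diff y q dq ->
  is_derive y h (fun z => pairing (p z) (q z))
    (pairing (dp h) (q y) + pairing (p y) (dq h)).
Proof.
move=> [dpy <-] [dqy <-].
have coord_comp (f : V -> Cvec R d) (c : {linear Cvec R d -> R}) :
    differentiable f y -> is_derive y h (fun z => c (f z)) (c ('d f y h)).
  exact: (is_derive_linear_comp _ _ (has_coordinates_Cvec R d)).
rewrite (_ : (fun z => pairing (p z) (q z)) = \sum_(j < d)
  2 *: ((fun z => re_coord j (p z)) * (fun z => re_coord j (q z))
   - (fun z => im_coord j (p z)) * (fun z => im_coord j (q z)))); last first.
  by apply/funext => z; rewrite fct_sumE.
have term j := is_deriveZ 2 (is_deriveB
  (is_deriveM (coord_comp _ (@re_coord R d j) dpy)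
              (coord_comp _ (@re_coord R d j) dqy))
  (is_deriveM (coord_comp _ (@im_coord R d j) dpy)
              (coord_comp _ (@im_coord R d j) dqy))).
apply: (is_derive_eq (is_derive_sum term)).
rewrite /pairing -big_split; apply: eq_bigr => j _ /=.
have expand (a b a' b' c e c' e' : R) :
    2 *: (a *: b' + b *: a' - (c *: e' + e *: c'))
    = 2 * (a' * b - c' * e) + 2 * (a * b' - c * e').
  by rewrite /GRing.scale /=; ring.
exact: expand.
Qed.

(** The identity behind the Legendre transform: the derivative of V enters
    once through the pairing and once through L, and the two contributions
    cancel when p is the derivative of L in the velocity. *)
Lemma derive_legendre_transform (R : realType) (d : nat) (Q T : normedModType R)
    (L : Q * Cvec R d * T -> R) (V : Q * Cvec R d * T -> Cvec R d)
    (y h : Q * Cvec R d * T) :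
  differentiable V y -> differentiable L (y.1.1, V y, y.2) ->
  (forall k, 'd L (y.1.1, V y, y.2) (0, k, 0) = pairing y.1.2 k) ->
  'D_h (fun z => pairing z.1.2 (V z) - L (z.1.1, V z, z.2)) y
  = pairing h.1.2 (V y) - 'd L (y.1.1, V y, y.2) (h.1.1, 0, h.2).
Proof.
move=> dV dL Lp.
have D1 := is_derive_pairing h (is_diff_fst_snd y) (differentiableP dV).
have D2 := is_derive_subst_middle h dV dL.
have [_ ->] := is_deriveB D1 D2.
have -> : (h.1.1, 'd V y h, h.2) = (h.1.1, 0, h.2) + (0, 'd V y h, 0).
  by congr (_, _, _); rewrite /= ?addr0 ?add0r.
rewrite linearD Lp.
have cancel (a b c : R) : a + b - (c + b) = a - c by ring.
exact: cancel.
Qed.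

Lemma hamiltonianE (R : realType) (d : nat) (L : phase R d -> R)
    (V : phase R d -> Cvec R d) (y : phase R d) :
  hamiltonian L V y = (pairing y.1.2 (V y) - L (y.1.1, V y, y.2))%:C.
Proof.
case: y => [[q p] t]; rewrite /hamiltonian /LC /= rmorphB /pairing rmorph_sum.
congr (_ - _); apply: eq_bigr => j _; rewrite /Defs.coord.
move: (p.1 0 j) (p.2 0 j) ((V (q, p, t)).1 0 j) ((V (q, p, t)).2 0 j).
by move=> a b c e; simpc; congr (_ +i* _); ring.
Qed.

Lemma diff_velocity_pairing (R : realType) (d : nat) (L : phase R d -> R)
    (x : phase R d) (k : Cvec R d) : differentiable L x ->
  'd L x ((0, k), 0) = pairing (momentum L x) k.
Proof.
move=> dL; rewrite velocity_sum linear_sum momentumE; apply: eq_bigr => j _.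
rewrite linearD [X in X + _ = _]linearZ [X in _ + X = _]linearZ.
rewrite -!deriveE// !mxE.
have expand (a b c e : R) :
    c * a + e * b = 2 * (2^-1 * a * c - - (2^-1 * b) * e) by field.
exact: expand.
Qed.

Lemma pairing0 (R : realType) (d : nat) (k : Cvec R d) : pairing 0 k = 0.
Proof. by rewrite /pairing big1// => j _; rewrite !mxE !mul0r subrr mulr0. Qed.

Lemma pairing_re (R : realType) (d : nat) (k : Cvec R d) (j : 'I_d) :
  pairing (delta_mx 0 j, 0) k = 2 * k.1 0 j.
Proof.
rewrite /pairing (bigD1 j)//= big1 ?addr0 => [|i ij]; rewrite !mxE.
  by rewrite !eqxx mul1r mul0r subr0.
by rewrite (negPf ij) andbF !mul0r subrr mulr0.
Qed.

Lemma pairing_im (R : realType) (d : nat) (k : Cvec R d) (j : 'I_d) :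
  pairing (0, delta_mx 0 j) k = - (2 * k.2 0 j).
Proof.
rewrite /pairing (bigD1 j)//= big1 ?addr0 => [|i ij]; rewrite !mxE.
  by rewrite !eqxx mul1r mul0r sub0r mulrN.
by rewrite (negPf ij) andbF !mul0r subrr mulr0.
Qed.

Lemma derive_hamiltonian (R : realType) (d : nat) (L : phase R d -> R)
    (V : phase R d -> Cvec R d) (y h : phase R d) :
  differentiable V y -> (forall x, differentiable L x) ->
  momentum L (y.1.1, V y, y.2) = y.1.2 ->
  'D_h (fun z => pairing z.1.2 (V z) - L (z.1.1, V z, z.2)) y
  = pairing h.1.2 (V y) - 'd L (y.1.1, V y, y.2) (h.1.1, 0, h.2).
Proof.
move=> dV dL mom; apply: derive_legendre_transform => // k.
by rewrite diff_velocity_pairing// mom.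
Qed.

Lemma wirt_momentum_hamiltonian (R : realType) (d : nat) (L : phase R d -> R)
    (V : phase R d -> Cvec R d) (y : phase R d) (j : 'I_d) :
  differentiable V y -> (forall x, differentiable L x) ->
  momentum L (y.1.1, V y, y.2) = y.1.2 ->
  wirt (dir_w R j) (hamiltonian L V) y = Defs.coord (V y) j.
Proof.
move=> dV dL mom; rewrite (funext (hamiltonianE L V)) wirt_real.
rewrite !(derive_hamiltonian _ dV dL mom) /= pairing_re pairing_im.
rewrite (_ : (0, 0, 0) = 0)// linear0 !subr0 mulrN opprK.
by rewrite !mulrA mulVf ?pnatr_eq0// !mul1r.
Qed.

Lemma wirt_position_hamiltonian (R : realType) (d : nat) (L : phase R d -> R)
    (V : phase R d -> Cvec R d) (y : phase R d) (j : 'I_d) :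
  differentiable V y -> (forall x, differentiable L x) ->
  momentum L (y.1.1, V y, y.2) = y.1.2 ->
  wirt (dir_q R j) (hamiltonian L V) y
  = - wirt (dir_q R j) (LC L) (y.1.1, V y, y.2).
Proof.
move=> dV dL mom; rewrite (funext (hamiltonianE L V)) !wirt_real.
rewrite !(derive_hamiltonian _ dV dL mom) /= pairing0 !sub0r !deriveE//.
by rewrite !mulrN; simpc.
Qed.

(** * Equivalence of the equations *)

Lemma near_cderive (R : realType) (V : normedModType R) (v : V)
    (f g : V -> R[i]) (x : V) :
  (\forall y \near x, f y = g y) -> cderive v f x = cderive v g x.
Proof.
move=> fg; rewrite /cderive; congr (_ +i* _); apply: near_eq_derive;
  by apply: filterS fg => y ->.
Qed.

Lemma near_wirt (R : realType) (V : normedModType R) (e : V * V)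
    (f g : V -> R[i]) (x : V) :
  (\forall y \near x, f y = g y) -> wirt e f x = wirt e g x.
Proof. by move=> fg; rewrite /wirt !(near_cderive _ fg). Qed.

Lemma near_wirtbar (R : realType) (V : normedModType R) (e : V * V)
    (f g : V -> R[i]) (x : V) :
  (\forall y \near x, f y = g y) -> wirtbar e f x = wirtbar e g x.
Proof. by move=> fg; rewrite /wirtbar !(near_cderive _ fg). Qed.

Lemma wirtbar_conj (R : realType) (V : normedModType R) (e : V * V)
    (f : V -> R[i]) (x : V) :
  (forall v, derivable (fun y => complex.Im (f y)) x v) ->
  wirtbar e (fun y => conjc (f y)) x = conjc (wirt e f x).
Proof.
move=> df.
have re v : 'D_v (fun y => complex.Re (conjc (f y))) x
    = 'D_v (fun y => complex.Re (f y)) x.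
  by congr ('D_v _ x); apply/funext => y; case: (f y).
have im v : 'D_v (fun y => complex.Im (conjc (f y))) x
    = - 'D_v (fun y => complex.Im (f y)) x.
  rewrite (_ : (fun y => _) = - (fun y => complex.Im (f y))); last first.
    by apply/funext => y; rewrite fctE /=; case: (f y).
  exact: deriveN.
rewrite wirtbarE wirtE !re !im opprK /=.
have conj_half (a b c g : R) : (2^-1 * (a + b)) +i* (2^-1 * (- c + g))
    = (2^-1 * (a + b)) -i* (2^-1 * (c - g)).
  by congr (_ +i* _); ring.
exact: conj_half.
Qed.

Lemma wirtbar_real_conj (R : realType) (V : normedModType R) (e : V * V)
    (f : V -> R) (x : V) :
  wirtbar e (fun y => (f y)%:C) x = conjc (wirt e (fun y => (f y)%:C) x).
Proof. by rewrite wirtbar_real wirt_real /= opprK. Qed.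

Lemma Cvec_eqP (R : realType) (d : nat) (u v : Cvec R d) :
  (forall j, Defs.coord u j = Defs.coord v j) <-> u = v.
Proof.
split=> [uv|-> //]; apply: injective_projections; apply/rowP => j.
  by case: (uv j).
by case: (uv j).
Qed.

Lemma of_coordK (R : realType) (d : nat) (c : 'I_d -> R[i]) (j : 'I_d) :
  Defs.coord (of_coord c) j = c j.
Proof. by rewrite /Defs.coord !mxE; case: (c j). Qed.

(** The first Hamilton equation says that the velocity of q is V (q, p, t);
    since V inverts the momentum, this means that p is the momentum of the jet
    of q.  The second one is then the Euler-Lagrange equation with p in place
    of the momentum. *)
Lemma hamiltonP (R : realType) (d : nat) (L : phase R d -> R)
    (U W : set (phase R d)) (V : phase R d -> Cvec R d)
    (q p : plane R -> Cvec R d) (t : plane R) :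
  (forall x, differentiable L x) -> local_inverse L U W V ->
  W (q t, p t, t) ->
  hamilton L V q p t <->
  [/\ U (jet q t), p t = momentum L (jet q t) &
    forall j, wirt (dir_q R j) (LC L) (jet q t)
      = wirt (dir_t R) (fun s => Defs.coord (p s) j) t].
Proof.
move=> dL [_ _ dV UW WU] Wt; have [UV mom] := WU _ _ _ Wt.
have wirt_p j := wirt_momentum_hamiltonian j (dV _ Wt) dL mom.
have wirt_q j := wirt_position_hamiltonian j (dV _ Wt) dL mom.
have vel j : Defs.coord (dt q t) j
    = wirt (dir_t R) (fun s => Defs.coord (q s) j) t by exact: of_coordK.
split=> [H|[Uq pq EL] j].
  have dtq : dt q t = V (q t, p t, t).
    by apply/Cvec_eqP => j; rewrite vel -wirt_p; exact: (H j).1.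
  rewrite /jet dtq; split; [exact: UV|exact: esym mom|move=> j].
  by apply: oppr_inj; rewrite (H j).2 wirt_q.
have dtq : V (q t, p t, t) = dt q t.
  by rewrite pq; exact: (UW _ _ _ Uq).2.
by rewrite wirt_p wirt_q /= dtq -vel EL.
Qed.

Lemma differentiable_derivable_Im (R : realType) (d : nat) (V : normedModType R)
    (p : V -> Cvec R d) (x v : V) (j : 'I_d) :
  differentiable p x ->
  derivable (fun s => complex.Im (Defs.coord (p s) j)) x v.
Proof.
move=> dp.
by have [] :=
  is_derive_linear_comp (@im_coord R d j) v (has_coordinates_Cvec R d) dp.
Qed.

(** As L is real, the second Euler-Lagrange equation is the conjugate of the
    first one.  Equality of p with the momentum is needed on a neighbourhood,
    since both are differentiated. *)
Lemma euler_lagrangeP (R : realType) (d : nat) (L : phase R d -> R)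
    (q p : plane R -> Cvec R d) (t : plane R) :
  differentiable p t ->
  (\forall s \near t, p s = momentum L (jet q s)) ->
  euler_lagrange L q t <->
  forall j, wirt (dir_q R j) (LC L) (jet q t)
      = wirt (dir_t R) (fun s => Defs.coord (p s) j) t.
Proof.
move=> dp pmom.
have near_p j : \forall s \near t,
    wirt (dir_w R j) (LC L) (jet q s) = Defs.coord (p s) j.
  by apply: filterS pmom => s ->; rewrite of_coordK.
have near_pbar j : \forall s \near t,
    wirtbar (dir_w R j) (LC L) (jet q s) = conjc (Defs.coord (p s) j).
  by apply: filterS pmom => s ->; rewrite of_coordK wirtbar_real_conj.
split=> [EL j|EL j]; first by rewrite (EL j).1; exact: near_wirt.
split; first by rewrite EL; apply/esym; exact: near_wirt.
rewrite wirtbar_real_conj -[wirt _ _ _]/(wirt (dir_q R j) (LC L) (jet q t)) EL.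
rewrite (near_wirtbar _ (near_pbar j)) wirtbar_conj// => v.
exact: differentiable_derivable_Im.
Qed.

Theorem lemma2p3 (R : realType) (d : nat) (L : phase R d -> R)
    (L_smooth : smooth L) (L_periodic : periodic_phase L)
    (L_legendre : legendre_like L) :
  (forall x : phase R d,
     ((1 < d)%N -> \det (momentum_jacobian L x) != 0) ->
     exists U W V, U x /\ local_inverse L U W V)
  /\
  (forall (U W : set (phase R d)) (V : phase R d -> Cvec R d),
     local_inverse L U W V ->
     forall Omega : set (plane R), open Omega ->
     forall q p : plane R -> Cvec R d, torus_map q -> torus_momentum p ->
     (forall t, Omega t -> W (q t, p t, t)) ->
     (forall t, Omega t ->
        [/\ U (jet q t), p t = momentum L (jet q t) & euler_lagrange L q t])
     <->
     (forall t, Omega t -> hamilton L V q p t)).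
Proof.
split=> [x detJ|U W V LI Omega Oopen q p _ [p_smooth _] WOmega].
  apply: local_inverse_exists; first exact: (L_smooth 2).
  have [d1|/detJ//] := leqP d 1.
  exact: momentum_jacobian_small.
have dL x : differentiable L x by exact: (L_smooth 1%N).1.
have dp t : differentiable p t by exact: (p_smooth 1%N).1.
have near_mom t : Omega t ->
    (forall s, Omega s -> p s = momentum L (jet q s)) ->
    \forall s \near t, p s = momentum L (jet q s).
  by move=> Ot pm; apply: filterS pm _; exact: open_nbhs_nbhs.
split=> [EL t Ot|H t Ot].
  have pmom : \forall s \near t, p s = momentum L (jet q s).
    by apply: near_mom => // s Os; have [] := EL s Os.
  apply/(hamiltonP dL LI (WOmega t Ot)).
  have [Ut pt ELt] := EL t Ot; split; [exact: Ut|exact: pt|].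
  by apply/(euler_lagrangeP (dp t) pmom).
have HP s (Os : Omega s) := (hamiltonP dL LI (WOmega s Os)).1 (H s Os).
have pmom : \forall s \near t, p s = momentum L (jet q s).
  by apply: near_mom => // s Os; have [] := HP s Os.
have [Ut pt Ht] := HP t Ot; split; [exact: Ut|exact: pt|].
by apply/(euler_lagrangeP (dp t) pmom).
Qed.
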